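(* Let $R$ be a semiprime ring, let $I$ be a nonzero ideal of $R$, and let $d:R\to R$ be a multiplicative semiderivation associated with a nonzero epimorphism $g$ of $R$. If $d([x,y])=0$ for all $x,y\in I$, then $[x,d(x)]=0$ for all $x\in I$.
   Context: Rings are associative and not assumed unital or commutative; ideals are two-sided. A ring $R$ is semiprime if for $x\in R$, $xRx=0$ implies $x=0$. For $x,y\in R$, $[x,y]=xy-yx$. A mapping $d:R\to R$ (not assumed additive) is a multiplicative semiderivation associated with a function $g:R\to R$ if (i) $d(xy)=d(x)g(y)+xd(y)=d(x)y+g(x)d(y)$ and (ii) $d(g(x))=g(d(x))$ hold for all $x,y\in R$. An epimorphism of $R$ is a surjective ring homomorphism $R\to R$; nonzero means not the zero map. *)

(* Defs.v *)
From HB Require Import structures.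
From mathcomp Require Import all_boot all_order all_algebra.

Set Implicit Arguments.
Unset Strict Implicit.
Unset Printing Implicit Defensive.

Import GRing.Theory.
Local Open Scope ring_scope.

(* MathComp's pzRingType is unital, so rings without an assumed identity are   *)
(* built here on top of zmodType.                                              *)
HB.mixin Record Zmodule_isRng R of GRing.Zmodule R := {
  rng_mul : R -> R -> R;
  rng_mulA : associative rng_mul;
  rng_mulDl : left_distributive rng_mul +%R;
  rng_mulDr : right_distributive rng_mul +%R
}.

#[short(type="rngType")]
HB.structure Definition Rng := { R of GRing.Zmodule R & Zmodule_isRng R }.

Reserved Notation "x ** y" (at level 40, left associativity).
Notation "x ** y" := (rng_mul x y) : ring_scope.

Definition semiprime (R : rngType) : Prop :=
  forall x : R, (forall r : R, x ** r ** x = 0) -> x = 0.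

Definition commutator (R : rngType) (x y : R) : R := x ** y - y ** x.

Definition two_sided_ideal (R : rngType) (I : R -> Prop) : Prop :=
  [/\ I 0,
      forall x y, I x -> I y -> I (x - y)
    & forall r x, I x -> I (r ** x) /\ I (x ** r)].

Definition epimorphism (R : rngType) (g : R -> R) : Prop :=
  [/\ {morph g : x y / x + y},
      {morph g : x y / x ** y}
    & forall y, exists x, g x = y].

Definition mult_semiderivation (R : rngType) (d g : R -> R) : Prop :=
  [/\ forall x y, d (x ** y) = d x ** g y + x ** d y,
      forall x y, d (x ** y) = d x ** y + g x ** d y
    & forall x, d (g x) = g (d x)].

(* Main.v *)
(* Since [x, yx] = [x, y] x, the semiderivation rule gives [x, y] d(x) = 0 on I; *)
(* substituting r y for y yields [x, r] I d(x) = 0 for every r in R. With        *)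
(* r = d(x), the element c = [x, d(x)] of I satisfies c I c = 0, so c = 0 by     *)
(* semiprimeness.                                                                *)
Require Import Defs.
From mathcomp Require Import all_boot all_order all_algebra.
Local Open Scope ring_scope.
Import GRing.Theory.

(** Expanding [d] on [x, yx] = [x, y]x kills the term with [g], so d(x) is annihilated on the left
    by [x, I]. The Leibniz rule for [x, ry] enlarges this to [x, R] I d(x) = 0, and r = d(x) yields
    cIc = 0 for c = [x, d(x)]. *)

Section RngTheory.
Variable R : rngType.
Implicit Types (x y z : R) (I : R -> Prop).

Lemma rng_mul0r y : 0 ** y = 0.
Proof. by apply: (addIr (0 ** y)); rewrite -rng_mulDl !add0r. Qed.

Lemma rng_mulr0 x : x ** 0 = 0.
Proof. by apply: (addIr (x ** 0)); rewrite -rng_mulDr !add0r. Qed.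

Lemma rng_mulBl x y z : (x - y) ** z = x ** z - y ** z.
Proof. by apply: (addIr (y ** z)); rewrite -rng_mulDl !subrK. Qed.

Lemma rng_mulBr x y z : z ** (x - y) = z ** x - z ** y.
Proof. by apply: (addIr (z ** y)); rewrite -rng_mulDr !subrK. Qed.

Lemma commutator_mulr x y : commutator x (y ** x) = commutator x y ** x.
Proof. by rewrite /commutator rng_mulBl !rng_mulA. Qed.

Lemma commutator_mull x y z :
  commutator x (y ** z) = commutator x y ** z + y ** commutator x z.
Proof. by rewrite /commutator rng_mulBl rng_mulBr !rng_mulA subrKA. Qed.

(** Semiprimeness is used twice: z = crc satisfies zsz = c(rcs)crc = 0 because rcs lies in [I], so
    cRc = 0. *)
Lemma semiprime_ideal_eq0 I c : semiprime R -> two_sided_ideal I -> I c ->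
  (forall y, I y -> c ** y ** c = 0) -> c = 0.
Proof.
move=> hR [_ _ IM] Ic cIc; apply: (hR) => r; apply: hR => s.
have -> : c ** r ** c ** s ** (c ** r ** c) = c ** (r ** c ** s) ** c ** r ** c.
  by rewrite !rng_mulA.
by rewrite cIc ?rng_mul0r //; apply: (IM s _ _).2; apply: (IM r c Ic).1.
Qed.

End RngTheory.

Theorem theorem1 (R : rngType) (I : R -> Prop) (d g : R -> R)
    (hR : semiprime R)
    (hI : two_sided_ideal I) (hI0 : exists a : R, I a /\ a <> 0)
    (hg : epimorphism g) (hg0 : exists a : R, g a <> 0)
    (hd : mult_semiderivation d g)
    (hcomm : forall x y : R, I x -> I y -> d (commutator x y) = 0) :
  forall x : R, I x -> commutator x (d x) = 0.
Proof.
move=> x Ix; case: (hI) => _ IB IM; case: hd => d_mul _ _.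
have xyd y : I y -> commutator x y ** d x = 0.
  move=> Iy; have := hcomm x (y ** x) Ix (IM y x Ix).1.
  by rewrite commutator_mulr d_mul hcomm // rng_mul0r add0r.
have xryd r y : I y -> commutator x r ** y ** d x = 0.
  (* [r] may lie outside [I], since ry is still in [I]. *)
  move=> Iy; have := xyd (r ** y) (IM r y Iy).1.
  by rewrite commutator_mull rng_mulDl -(rng_mulA r) xyd // rng_mulr0 addr0.
apply: (semiprime_ideal_eq0 _ _ _ hR hI).
  by apply: IB; [apply: (IM _ _ Ix).2 | apply: (IM _ _ Ix).1].
(* Only the right-hand c is expanded: cyc = c(yx)d(x) - (cyd(x))x, and both terms vanish. *)
move=> y Iy; rewrite {2}/commutator rng_mulBr !rng_mulA xryd // rng_mul0r subr0.
by rewrite -(rng_mulA _ y) xryd //; apply: (IM x y Iy).2.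
Qed.
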